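(* Let $R_0$ be $\mathbb{Q}$ or $\mathbb{F}_\ell$ and let $R$ be an algebraic closure of $R_0$. Let $H_1,H_2$ be locally profinite groups such that $H_1\times H_2$ has open subgroups of invertible pro-order in $R$, and such that all irreducible representations in $\mathrm{Rep}_R(H_1)$ and $\mathrm{Rep}_R(H_2)$ are admissible. Let $V\in\mathrm{Rep}_R(H_1\times H_2)$. Then, for all $\sigma\in\mathrm{Gal}_{R_0}(R)$ and for all $\pi_1\in\mathrm{Irr}_R(H_1)$, we have $${}^\sigma\Theta_V(\pi_1)\simeq\Theta_{{}^\sigma V}({}^\sigma\pi_1).$$
   Context: $\mathrm{Rep}_R(G)$ is the category of smooth $R[G]$-modules, $\mathrm{Irr}_R(G)$ the set of isomorphism classes of irreducible ones; a representation is admissible if its $K$-fixed vectors are finite dimensional for all compact open subgroups $K$. The pro-order of a compact open subgroup is the least common multiple of the cardinalities of its finite quotients. For a representation $\pi$ over $R$ and $\sigma\in\mathrm{Gal}_{R_0}(R)$, ${}^\sigma\pi$ is the representation obtained by applying $\sigma$ to the matrix coefficients of $\pi$ in some $R$-basis (equivalently, the same group action with scalars acting through $\sigma^{-1}$). For $V\in\mathrm{Rep}_R(H_1\times H_2)$ and $\pi_1\in\mathrm{Irr}_R(H_1)$, the largest $\pi_1$-isotypic quotient is $V_{\pi_1}=V/\bigcap_{f\in\mathrm{Hom}_{H_1}(V,\pi_1)}\mathrm{Ker}(f)$, and the isotypic lift $\Theta_V(\pi_1)\in\mathrm{Rep}_R(H_2)$ is the representation, unique up to isomorphism, such that $V_{\pi_1}\simeq\Theta_V(\pi_1)\otimes_R\pi_1$.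 *)

(* Defs.v *)
From HB Require Import structures.
From mathcomp Require Import all_boot all_order all_algebra.
From mathcomp Require Import boolp classical_sets functions cardinality.
From mathcomp Require Import topology.
From mathcomp.multinomials Require Import freeg.

Set Implicit Arguments.
Unset Strict Implicit.
Unset Printing Implicit Defensive.

Import GRing.Theory.

Local Open Scope classical_set_scope.
Local Open Scope ring_scope.

Declare Scope rep_scope.
Delimit Scope rep_scope with rep.

HB.mixin Record isTopologicalGroup G of Group G & Topological G := {
  mulg_continuous : continuous (fun x : G * G => (x.1 * x.2)%g);
  invg_continuous : continuous (fun x : G => (x^-1)%g)
}.

#[short(type="topGroupType")]
HB.structure Definition TopologicalGroup :=
  {G of isTopologicalGroup G & Group G & Topological G}.

Section ProductGroup.
Variables G H : topGroupType.

Let mul_cont : continuous (fun x : (G * H) * (G * H) => (x.1 * x.2)%g).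
Proof.
move=> [[g1 h1] [g2 h2]] /=.
apply: cvg_pair => /=.
- apply: (@continuous2_cvg _ _ _ _ _ _
    (fun x : (G * H) * (G * H) => x.1.1) (fun x => x.2.1) (fun x y : G => (x * y)%g)).
  + exact: (mulg_continuous (g1, g2)).
  + by apply: cvg_comp; [exact: cvg_fst | exact: cvg_fst].
  + by apply: cvg_comp; [exact: cvg_snd | exact: cvg_fst].
- apply: (@continuous2_cvg _ _ _ _ _ _
    (fun x : (G * H) * (G * H) => x.1.2) (fun x => x.2.2) (fun x y : H => (x * y)%g)).
  + exact: (mulg_continuous (h1, h2)).
  + by apply: cvg_comp; [exact: cvg_fst | exact: cvg_snd].
  + by apply: cvg_comp; [exact: cvg_snd | exact: cvg_snd].
Qed.

Let inv_cont : continuous (fun x : G * H => (x^-1)%g).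
Proof.
move=> [g h] /=; apply: cvg_pair => /=.
- by apply: (cvg_comp _ (fun x : G => (x^-1)%g)); [exact: cvg_fst | exact: invg_continuous].
- by apply: (cvg_comp _ (fun x : H => (x^-1)%g)); [exact: cvg_snd | exact: invg_continuous].
Qed.

HB.instance Definition _ :=
  isTopologicalGroup.Build (G * H)%type mul_cont inv_cont.

End ProductGroup.

Definition is_subgroup (G : groupType) (K : set G) : Prop :=
  K 1%g /\ forall x y, K x -> K y -> K (x * y^-1)%g.

Section LocallyProfinite.
Variable G : topGroupType.
Implicit Types K N : set G.

Definition compact_open_subgroup K : Prop :=
  [/\ is_subgroup K, compact K & open K].

Definition locally_profinite : Prop :=
  hausdorff_space G /\
  forall U : set G, nbhs 1%g U ->
    exists2 K, compact_open_subgroup K & K `<=` U.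

(** Normality is relative to [K], not to the ambient group. *)
Definition open_normal_subgroup K N : Prop :=
  [/\ is_subgroup N, open N, N `<=` K &
      forall k n, K k -> N n -> N (n ^ k)%g].

Definition left_cosets K N : set (set G) :=
  [set [set (k * n)%g | n in N] | k in K].

Definition finite_quotient_card K (m : nat) : Prop :=
  exists2 N, open_normal_subgroup K N & (left_cosets K N #= `I_m)%card.

(** The pro-order is a supernatural number; it is described by the natural
    numbers dividing it.  As it is a least common multiple, a prime power
    divides it if and only if it divides one of the cardinalities. *)
Definition dvd_pro_order K (n : nat) : Prop :=
  forall p k, prime p -> (p ^ k %| n)%N ->
    exists2 m, finite_quotient_card K m & (p ^ k %| m)%N.

Definition invertible_pro_order (R : fieldType) K : Prop :=
  forall p, prime p -> dvd_pro_order K p -> p%:R != 0 :> R.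

End LocallyProfinite.

Section Span.
Variables (R : fieldType) (V : lmodType R).

Definition span (s : seq V) : set V :=
  [set v | exists c : nat -> R, v = \sum_(i < size s) c i *: s`_i].

Definition finite_dimensional (W : set V) : Prop := exists s, W = span s.

End Span.

Record rep (R : fieldType) (G : groupType) := Rep {
  rep_space :> lmodType R;
  act : G -> {linear rep_space -> rep_space};
  act1 : forall v, act 1%g v = v;
  actM : forall g h v, act (g * h)%g v = act g (act h v)
}.

Arguments act {R G V} g : rename.
Arguments act1 {R G V} v : rename.
Arguments actM {R G V} g h v : rename.

Record subrep (R : fieldType) (G : groupType) (V : rep R G) := Subrep {
  subrep_set :> set V;
  subrep0 : subrep_set 0;
  subrepD : forall v w, subrep_set v -> subrep_set w -> subrep_set (v + w);
  subrepZ : forall (a : R) v, subrep_set v -> subrep_set (a *: v);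
  subrep_act : forall g v, subrep_set v -> subrep_set (act g v)
}.

Definition equivariant (R : fieldType) (G : groupType) (V W : rep R G)
    (f : V -> W) : Prop :=
  forall g v, f (act g v) = act g (f v).

Definition rep_iso (R : fieldType) (G : groupType) (V W : rep R G) : Prop :=
  exists f : {linear V -> W}, bijective f /\ equivariant f.

Notation "V ~= W" := (rep_iso V W) (at level 70) : rep_scope.

Definition irreducible (R : fieldType) (G : groupType) (V : rep R G) : Prop :=
  (exists v : V, v != 0) /\
  forall W : subrep V, W = [set 0] :> set V \/ W = setT :> set V.

Section Smooth.
Variables (R : fieldType) (G : topGroupType) (V : rep R G).

Definition smooth : Prop := forall v : V, open [set g : G | act g v = v].

Definition fixed_vectors (K : set G) : set V :=
  [set v | forall g, K g -> act g v = v].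

Definition admissible : Prop :=
  forall K, compact_open_subgroup K -> finite_dimensional (fixed_vectors K).

End Smooth.

Section QuotientRep.
Variables (R : fieldType) (G : groupType) (V : rep R G) (W : subrep V).

Definition in_subrep : {pred V} := fun v => `[< subrep_set W v >].

Let in_subrep_closed : zmod_closed in_subrep.
Proof.
split; first exact/asboolP/subrep0.
move=> v w /asboolP Wv /asboolP Ww; apply/asboolP.
by apply: subrepD => //; rewrite -scaleN1r; exact: subrepZ.
Qed.

HB.instance Definition _ := GRing.isZmodClosed.Build V in_subrep in_subrep_closed.

Definition quot_space := Quotient.quot in_subrep.

HB.instance Definition _ := GRing.Zmodule.on quot_space.

Definition quot_pi (v : V) : quot_space := (\pi_(Quotient.quot in_subrep) v)%qT.

Lemma quot_piP v w : quot_pi v = quot_pi w <-> subrep_set W (v - w).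
Proof.
split=> [/eqP|Wvw].
  by rewrite /quot_pi -Quotient.idealrBE => /asboolP.
by apply/eqP; rewrite /quot_pi -Quotient.idealrBE; exact/asboolP.
Qed.

Lemma quot_piD v w : quot_pi (v + w) = quot_pi v + quot_pi w.
Proof. exact: raddfD. Qed.

Lemma quot_pi_repr (x : quot_space) : quot_pi (repr x) = x.
Proof. exact: reprK. Qed.

Definition quot_scale (a : R) (x : quot_space) : quot_space :=
  quot_pi (a *: repr x).

Let quot_scale_pi a v : quot_scale a (quot_pi v) = quot_pi (a *: v).
Proof.
apply/quot_piP; rewrite -scalerBr; apply: subrepZ.
by apply/quot_piP; rewrite quot_pi_repr.
Qed.

Let quot_scaleA a b x : quot_scale a (quot_scale b x) = quot_scale (a * b) x.
Proof. by rewrite -(quot_pi_repr x) !quot_scale_pi scalerA. Qed.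

Let quot_scale1 : left_id 1 quot_scale.
Proof. by move=> x; rewrite -(quot_pi_repr x) quot_scale_pi scale1r. Qed.

Let quot_scaleDr : right_distributive quot_scale +%R.
Proof.
move=> a x y; rewrite -(quot_pi_repr x) -(quot_pi_repr y).
by rewrite -quot_piD !quot_scale_pi scalerDr quot_piD.
Qed.

Let quot_scaleDl x : {morph quot_scale^~ x : a b / a + b}.
Proof.
move=> a b; rewrite -(quot_pi_repr x) !quot_scale_pi.
by rewrite scalerDl quot_piD.
Qed.

HB.instance Definition _ := GRing.Zmodule_isLmodule.Build R quot_space
  quot_scaleA quot_scale1 quot_scaleDr quot_scaleDl.

Lemma quot_piZ a v : quot_pi (a *: v) = a *: quot_pi v.
Proof. exact/esym/quot_scale_pi. Qed.

Definition quot_act (g : G) (x : quot_space) : quot_space :=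
  quot_pi (act g (repr x)).

Lemma quot_act_pi g v : quot_act g (quot_pi v) = quot_pi (act g v).
Proof.
apply/quot_piP; rewrite -linearB; apply: subrep_act.
by apply/quot_piP; rewrite quot_pi_repr.
Qed.

Let quot_act_linear g : linear (quot_act g).
Proof.
move=> a x y; rewrite -(quot_pi_repr x) -(quot_pi_repr y).
by rewrite -quot_piZ -quot_piD !quot_act_pi linearP quot_piD quot_piZ.
Qed.

HB.instance Definition _ g :=
  GRing.isLinear.Build R quot_space quot_space *:%R (quot_act g)
    (quot_act_linear g).

Let quot_act1 x : quot_act 1%g x = x.
Proof. by rewrite -(quot_pi_repr x) quot_act_pi act1. Qed.

Let quot_actM g h x : quot_act (g * h)%g x = quot_act g (quot_act h x).
Proof. by rewrite -(quot_pi_repr x) !quot_act_pi actM. Qed.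

Definition quot_rep : rep R G :=
  @Rep R G quot_space quot_act quot_act1 quot_actM.

End QuotientRep.

Section Tensor.
Variables (R : fieldType) (G1 G2 : groupType) (A : rep R G2) (B : rep R G1).

Local Notation F := {freeg (A * B)%type / R}.

Let fglift_linear (M : lmodType R) (f : A * B -> M) : linear (fglift f).
Proof.
move=> a x y.
have addf : zmod_morphism (fglift f) := lift_is_additive f.
pose fA := GRing.isZmodMorphism.Build _ _ (fglift f) addf.
pose fL : {additive F -> M} := HB.pack (fglift f) fA.
rewrite -[fglift f]/(fL : _ -> _) raddfD; congr (_ + _).
have fE D : fglift f D = \sum_(z <- dom D) coeff z D *: f z.
  rewrite -{1}(freeg_sumE D) -[fglift f]/(fL : _ -> _) raddf_sum.
  by apply: eq_bigr => z _; rewrite /= liftU.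
have -> : a *: x = \sum_(z <- dom x) << a * coeff z x *g z >>.
  rewrite -{1}(freeg_sumE x) scaler_sumr; apply: eq_bigr => z _.
  by apply/eqP/freeg_eqP => t; rewrite coeffZ !coeffU mulrA.
rewrite raddf_sum /= fE scaler_sumr.
by apply: eq_bigr => z _; rewrite /= liftU scalerA.
Qed.

Definition free_act (g : G1 * G2) : F -> F :=
  fglift (fun p : A * B => << (act g.2 p.1, act g.1 p.2) >> : F).

HB.instance Definition _ g :=
  GRing.isLinear.Build R F F *:%R (free_act g) (fglift_linear _).

Lemma free_actU g (p : A * B) :
  free_act g << p >> = << (act g.2 p.1, act g.1 p.2) >>.
Proof. by rewrite /free_act liftU scale1r. Qed.

Let free_ext (f h : {linear F -> F}) :
  (forall p, f << p >> = h << p >>) -> f =1 h.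
Proof.
move=> fh x; rewrite -(freeg_sumE x) !raddf_sum; apply: eq_bigr => z _.
suff -> : << coeff z x *g z >> = coeff z x *: << z >> :> F by rewrite /= !linearZ /= fh.
by apply/eqP/freeg_eqP => t; rewrite coeffZ !coeffU mul1r.
Qed.

Let free_act1 x : free_act 1%g x = x.
Proof.
apply: (free_ext (f := free_act 1%g) (h := idfun)) => -[a b].
by rewrite /= free_actU /= !act1.
Qed.

Let free_actM g h x : free_act (g * h)%g x = free_act g (free_act h x).
Proof.
apply: (free_ext (f := free_act (g * h)%g) (h := free_act g \o free_act h)).
by move=> [a b] /=; rewrite !free_actU /= !actM.
Qed.

Definition free_rep : rep R (G1 * G2)%type :=
  @Rep R (G1 * G2)%type F free_act free_act1 free_actM.

Inductive tensor_relation : set F :=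
| TensorRelDl a a' b :
    tensor_relation (<< (a + a', b) >> - << (a, b) >> - << (a', b) >>)
| TensorRelDr a b b' :
    tensor_relation (<< (a, b + b') >> - << (a, b) >> - << (a, b') >>)
| TensorRelZl c a b :
    tensor_relation (<< (c *: a, b) >> - c *: << (a, b) >>)
| TensorRelZr c a b :
    tensor_relation (<< (a, c *: b) >> - c *: << (a, b) >>)
| TensorRel0 : tensor_relation 0
| TensorRelD x y :
    tensor_relation x -> tensor_relation y -> tensor_relation (x + y)
| TensorRelZ c x : tensor_relation x -> tensor_relation (c *: x).

Let tensor_relation_act (g : G1 * G2) (x : free_rep) :
  tensor_relation x -> tensor_relation (act g x).
Proof.
rewrite -[act g x]/(free_act g x).
have actB y z : free_act g (y - z) = free_act g y - free_act g z.
  exact: linearB.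
have actZ c y : free_act g (c *: y) = c *: free_act g y by exact: linearZ.
elim=> [a a' b|a b b'|c a b|c a b||y z _ IHy _ IHz|c y _ IHy].
- by rewrite 2!actB !free_actU /= (linearD (act g.2)); exact: TensorRelDl.
- by rewrite 2!actB !free_actU /= (linearD (act g.1)); exact: TensorRelDr.
- by rewrite actB actZ !free_actU /= (linearZ_LR (act g.2)); exact: TensorRelZl.
- by rewrite actB actZ !free_actU /= (linearZ_LR (act g.1)); exact: TensorRelZr.
- by rewrite linear0; exact: TensorRel0.
- by rewrite linearD; exact: TensorRelD.
- by rewrite actZ; exact: TensorRelZ.
Qed.

Definition tensor_subrep : subrep free_rep :=
  @Subrep R _ free_rep tensor_relation
    TensorRel0 TensorRelD TensorRelZ tensor_relation_act.

(** [A (x) B] as a representation of [G1 * G2]: the second factor acts on the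
    left-hand side [A] and the first factor on the right-hand side [B]. *)
Definition tensor_rep : rep R (G1 * G2)%type := quot_rep tensor_subrep.

End Tensor.

Section Isotypic.
Variables (R : fieldType) (G1 G2 : groupType).
Variables (V : rep R (G1 * G2)%type) (pi1 : rep R G1).

Definition is_hom1 (f : {linear V -> pi1}) : Prop :=
  forall (g : G1) (v : V), f (act (g, 1%g) v) = act g (f v).

Definition isotypic_kernel_set : set V :=
  [set v | forall f : {linear V -> pi1}, is_hom1 f -> f v = 0].

Let isotypic_kernel0 : isotypic_kernel_set 0.
Proof. by move=> f _; rewrite linear0. Qed.

Let isotypic_kernelD v w : isotypic_kernel_set v -> isotypic_kernel_set w ->
  isotypic_kernel_set (v + w).
Proof. by move=> kv kw f hf; rewrite linearD kv // kw // addr0. Qed.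

Let isotypic_kernelZ (a : R) v :
  isotypic_kernel_set v -> isotypic_kernel_set (a *: v).
Proof. by move=> kv f hf; rewrite linearZ /= kv // scaler0. Qed.

Let isotypic_kernel_act (g : G1 * G2) v :
  isotypic_kernel_set v -> isotypic_kernel_set (act g v).
Proof.
case: g => g1 g2 kv f hf.
have -> : (g1, g2) = ((g1, 1) * (1, g2))%g :> G1 * G2.
  by congr pair; rewrite /= (mulg1, mul1g).
rewrite actM hf.
pose fg := f \o act (1%g, g2) : {linear V -> pi1}.
have hfg : is_hom1 fg.
  move=> h w; rewrite /fg /= -actM -hf -actM; congr (f (act _ w)).
  by congr pair; rewrite /= !(mulg1, mul1g).
by have /= -> := kv fg hfg; rewrite linear0.
Qed.

Definition isotypic_kernel : subrep V :=
  @Subrep R _ V isotypic_kernel_set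
    isotypic_kernel0 isotypic_kernelD isotypic_kernelZ isotypic_kernel_act.

Definition isotypic_quotient : rep R (G1 * G2)%type := quot_rep isotypic_kernel.

End Isotypic.

(** [Theta] is determined only up to isomorphism, so that it is given by its
    defining property. *)
Definition is_isotypic_lift (R : fieldType) (G1 G2 : topGroupType)
    (V : rep R (G1 * G2)%type) (pi1 : rep R G1) (Theta : rep R G2) : Prop :=
  smooth Theta /\ (isotypic_quotient V pi1 ~= tensor_rep Theta pi1)%rep.

Inductive prime_field : fieldType -> Prop :=
| PrimeFieldQ : prime_field rat
| PrimeFieldF l of prime l : prime_field 'F_l.

Definition algebraic_closure (R0 : fieldType) (R : closedFieldType)
    (iota : {rmorphism R0 -> R}) : Prop :=
  forall x : R, algebraicOver iota x.

Record galois_aut (R0 R : fieldType) (iota : {rmorphism R0 -> R}) := GaloisAut {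
  gal_fun :> {rmorphism R -> R};
  gal_inv : {rmorphism R -> R};
  gal_funK : cancel gal_fun gal_inv;
  gal_invK : cancel gal_inv gal_fun;
  gal_fixes : forall x, gal_fun (iota x) = iota x
}.

(** The carrier of [V]; it mentions [sigma] because the scalar action put on it
    below depends on [sigma]. *)
Definition twist_space (R0 R : fieldType) (iota : {rmorphism R0 -> R})
  (sigma : galois_aut iota) (G : groupType) (V : rep R G) : Type := V.

Section Twist.
Variables (R0 R : fieldType) (iota : {rmorphism R0 -> R}).
Variables (sigma : galois_aut iota) (G : groupType) (V : rep R G).
Local Notation twist_space := (twist_space sigma V).

HB.instance Definition _ := GRing.Zmodule.on twist_space.

Definition twist_scale (a : R) (v : twist_space) : twist_space :=
  gal_inv sigma a *: (v : V).

Let twist_scaleA a b v : twist_scale a (twist_scale b v) = twist_scale (a * b) v.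
Proof. by rewrite /twist_scale scalerA rmorphM. Qed.

Let twist_scale1 : left_id 1 twist_scale.
Proof. by move=> v; rewrite /twist_scale rmorph1 scale1r. Qed.

Let twist_scaleDr : right_distributive twist_scale +%R.
Proof. by move=> a v w; rewrite /twist_scale scalerDr. Qed.

Let twist_scaleDl v : {morph twist_scale^~ v : a b / a + b}.
Proof. by move=> a b; rewrite /twist_scale rmorphD scalerDl. Qed.

HB.instance Definition _ := GRing.Zmodule_isLmodule.Build R twist_space
  twist_scaleA twist_scale1 twist_scaleDr twist_scaleDl.

Definition twist_act (g : G) (v : twist_space) : twist_space := act g (v : V).

Let twist_act_linear g : linear (twist_act g).
Proof. by move=> a v w; rewrite /twist_act linearP. Qed.

HB.instance Definition _ g :=
  GRing.isLinear.Build R twist_space twist_space *:%R (twist_act g)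
    (twist_act_linear g).

Let twist_act1 v : twist_act 1%g v = v.
Proof. exact: act1. Qed.

Let twist_actM g h v : twist_act (g * h)%g v = twist_act g (twist_act h v).
Proof. exact: actM. Qed.

Definition twist : rep R G :=
  @Rep R G twist_space twist_act twist_act1 twist_actM.

End Twist.

(* Main.v *)
(** Applying [sigma] to scalars is an equivalence that carries homomorphisms
    [V -> pi1] to homomorphisms [sigma V -> sigma pi1], hence the isotypic
    kernels to each other, and it commutes with tensor products; so
    [sigma Theta (x) sigma pi1 ~= Theta' (x) sigma pi1].  It remains to cancel
    [B = sigma pi1].  By Schur's lemma (an endomorphism preserves the nonzero
    finite-dimensional space of [K]-fixed vectors for small [K], so has an
    eigenvector) the endomorphisms of [B] are scalars.  Consequently every
    [H1]-homomorphism [B -> A (x) B] has the form [b |-> a (x) b]: contracting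
    it with a linear form on [A] gives a scalar endomorphism of [B], and
    contractions with linear forms separate the points of [A (x) B]. *)

Require Import Defs.
From HB Require Import structures.
From mathcomp Require Import all_boot all_order all_algebra.
From mathcomp Require Import boolp classical_sets functions cardinality.
From mathcomp Require Import topology.
From mathcomp.multinomials Require Import freeg.

Set Implicit Arguments.
Unset Strict Implicit.
Unset Printing Implicit Defensive.

Import GRing.Theory.

Local Open Scope classical_set_scope.
Local Open Scope ring_scope.

Definition linear_map (R : fieldType) (U W : lmodType R) (f : U -> W)
    (lf : linear f) : {linear U -> W} :=
  HB.pack f (GRing.isLinear.Build R U W *:%R f lf).

(** * Spans of finite sequences and separating linear forms, in arbitrary dimension *)

Section LinearAlgebra.
Variables (R : fieldType) (V : lmodType R).

Lemma span_lincomb (s : seq V) (a : R) (x y : V) :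
  Defs.span s x -> Defs.span s y -> Defs.span s (a *: x + y).
Proof.
move=> [c ->] [d ->]; exists (fun i => a * c i + d i).
rewrite scaler_sumr -big_split; apply: eq_bigr => i _ /=.
by rewrite scalerDl scalerA.
Qed.

Lemma span0 (s : seq V) : Defs.span s 0.
Proof.
by exists (fun=> 0); rewrite big1 // => i _; rewrite scale0r.
Qed.

Lemma span_nth (s : seq V) (i : 'I_(size s)) : Defs.span s s`_i.
Proof.
exists (fun j => (j == i :> nat)%:R); rewrite (bigD1 i) //= eqxx scale1r big1 ?addr0//.
by move=> j; rewrite -val_eqE => /negPf /= ->; rewrite scale0r.
Qed.

(** By Zorn's lemma there is a maximal subspace [M] that contains the span and avoids [v].
    Maximality makes the line through [v] a complement of [M], and [l] is the coordinate along
    [v]. *)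
Lemma functional_off_span (s : seq V) (v : V) : ~ Defs.span s v ->
  exists l : {linear V -> R^o},
    l v = 1 /\ forall w, Defs.span s w -> l w = 0.
Proof.
move=> sv.
(* The subspace is [span s] united with [X], not [X] itself: the empty chain has the empty set as
   its union, and this must still satisfy [P]. *)
pose P (X : set V) := ~ (Defs.span s `|` X) v /\
  forall a x y, (Defs.span s `|` X) x -> (Defs.span s `|` X) y ->
    (Defs.span s `|` X) (a *: x + y).
have [F FP Ftot|X [[Xv XZ] Xmax]] := @Zorn_bigcup V P.
  split=> [[//|[X FX Xv]]|a x y].
    by have [+ _] := FP _ FX; apply; right.
  have one Y : F Y -> (Defs.span s `|` Y) x -> (Defs.span s `|` Y) y ->
      (Defs.span s `|` \bigcup_(X in F) X) (a *: x + y).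
    move=> FY Yx Yy; have [_ /(_ a x y Yx Yy)[|Yxy]] := FP _ FY; first by left.
    by right; exists Y.
  case=> [sx|[X FX Xx]] [sy|[Y FY Yy]].
  - by left; exact: span_lincomb.
  - by apply: (one Y); [|left|right].
  - by apply: (one X); [|right|left].
  - have [XY|YX] := Ftot _ _ FX FY.
      by apply: (one Y) => //; right => //; exact: XY.
    by apply: (one X) => //; right => //; exact: YX.
pose M := Defs.span s `|` X.
have M0 : M 0 by left; exact: span0.
have MZ a x : M x -> M (a *: x) by move=> Mx; rewrite -[_ *: _]addr0; exact: XZ.
have MD x y : M x -> M y -> M (x + y).
  by move=> Mx My; rewrite -[x]scale1r; exact: XZ.
have MB x y : M x -> M y -> M (x - y).
  by move=> Mx My; rewrite addrC -scaleN1r; exact: XZ.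
have ex x : exists c, M (x - c *: v).
  have [Mx|nMx] := pselect (M x); first by exists 0; rewrite scale0r subr0.
  (* [Y] is the subspace [M + R x], strictly larger than [X]; by maximality it must contain [v], and
     solving for [x] gives the coefficient. *)
  pose Y := [set y | exists m a, M m /\ y = m + a *: x].
  have [m [a [Mm vE]]] : Y v.
    apply: contrapT => nYv; apply: (Xmax Y); last split.
    - split=> [y Xy|YX].
        by exists y, 0; rewrite scale0r addr0; split => //; right.
      apply: nMx; right; apply: YX.
      by exists 0, 1; rewrite scale1r add0r.
    - by case=> [/sv|/nYv].
    - move=> a y z SYy SYz; right.
      have sY t : (Defs.span s `|` Y) t -> Y t.
        by case=> // st; exists t, 0; rewrite scale0r addr0; split => //; left.
      have [m [b [Mm ->]]] := sY _ SYy; have [n [c [Mn ->]]] := sY _ SYz.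
      exists (a *: m + n), (a * b + c); split; first exact: XZ.
      by rewrite scalerDr scalerDl scalerA addrACA.
  have a0 : a != 0.
    by apply/eqP => a0; apply: Xv; rewrite vE a0 scale0r addr0.
  exists a^-1; rewrite vE scalerDr scalerA mulVf // scale1r opprD addrCA subrr addr0.
  by rewrite -scaleN1r; do 2!apply: (MZ).
have uniq x c d : M (x - c *: v) -> M (x - d *: v) -> c = d.
  move=> Mc Md; apply: contrapT => /eqP; rewrite -subr_eq0 => cd.
  apply: Xv; rewrite -/M -[v]scale1r -(mulVf cd) -scalerA; apply: (MZ).
  rewrite (_ : _ *: v = (x - d *: v) - (x - c *: v)); first exact: MB.
  by rewrite opprB [RHS]addrC subrKA scalerBl.
pose l x : R^o := projT1 (cid (ex x)).
have lP x : M (x - l x *: v) := projT2 (cid (ex x)).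
have lE x c : M (x - c *: v) -> l x = c by move=> Mx; exact: (uniq x).
have llin : linear l.
  move=> a x y; apply: lE.
  rewrite (_ : _ - _ = a *: (x - l x *: v) + (y - l y *: v)); first exact: (XZ _ _ _ (lP x) (lP y)).
  by rewrite scalerBr scalerDl scalerA opprD addrACA.
exists (linear_map llin); split=> [|w sw]; apply: lE.
  by rewrite scale1r subrr.
by rewrite scale0r subr0; left.
Qed.

Lemma functional_nonzero (v : V) : v != 0 -> exists l : {linear V -> R^o}, l v = 1.
Proof.
move=> v0; have [|l [lv _]] := @functional_off_span [::] v; last by exists l.
by case=> c; rewrite big_ord0 => /eqP; exact/negP.
Qed.

End LinearAlgebra.

(** * The projection onto a quotient representation as a linear equivariant map *)

Section Quotient.
Variables (R : fieldType) (G : groupType) (V : rep R G) (W : subrep V).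

Lemma quot_pi_linear : linear (quot_pi W : V -> quot_rep W).
Proof. by move=> a x y; rewrite quot_piD quot_piZ. Qed.

Definition quot_map : {linear V -> quot_rep W} := linear_map quot_pi_linear.

Lemma quot_map_eq0 v : quot_map v = 0 <-> subrep_set W v.
Proof.
rewrite -[quot_map v]/(quot_pi W v) -[0](linear0 quot_map).
by rewrite quot_piP subr0.
Qed.

Lemma quot_map_surj (x : quot_rep W) : exists v, quot_map v = x.
Proof. by exists (repr (x : quot_space W)); exact: quot_pi_repr. Qed.

Lemma act_quot_map g v : act g (quot_map v) = quot_map (act g v).
Proof. exact: quot_act_pi. Qed.

End Quotient.
Arguments quot_map {R G V} W.

(** * Pure tensors and the universal property of the tensor product *)

Section TensorProduct.
Variables (R : fieldType) (G1 G2 : groupType) (A : rep R G2) (B : rep R G1).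
Local Notation F := {freeg (A * B)%type / R}.

Definition tens (a : A) (b : B) : tensor_rep A B :=
  quot_map (tensor_subrep A B) (<< (a, b) >> : F).

Lemma tens_eq (x y : F) : tensor_relation (x - y) ->
  quot_map (tensor_subrep A B) x = quot_map (tensor_subrep A B) y.
Proof. by move=> xy; apply/quot_piP. Qed.

Lemma tensDl a a' b : tens (a + a') b = tens a b + tens a' b.
Proof.
rewrite -linearD; apply: tens_eq; rewrite opprD addrA; exact: TensorRelDl.
Qed.

Lemma tensDr a b b' : tens a (b + b') = tens a b + tens a b'.
Proof.
rewrite -linearD; apply: tens_eq; rewrite opprD addrA; exact: TensorRelDr.
Qed.

Lemma tensZl c a b : tens (c *: a) b = c *: tens a b.
Proof. by rewrite -linearZ_LR; apply: tens_eq; exact: TensorRelZl. Qed.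

Lemma tensZr c a b : tens a (c *: b) = c *: tens a b.
Proof. by rewrite -linearZ_LR; apply: tens_eq; exact: TensorRelZr. Qed.

Lemma tens_linear_l b : linear (tens^~ b).
Proof. by move=> c x y; rewrite tensDl tensZl. Qed.

Lemma tens_linear_r a : linear (tens a).
Proof. by move=> c x y; rewrite tensDr tensZr. Qed.

Lemma act_tens g a b : act g (tens a b) = tens (act g.2 a) (act g.1 b).
Proof. by rewrite act_quot_map /= free_actU. Qed.

Lemma freegZ (K : choiceType) (c : R) (k : K) :
  << c *g k >> = c *: << k >> :> {freeg K / R}.
Proof. by apply/eqP/freeg_eqP => t; rewrite coeffZ !coeffU mul1r. Qed.

(** Coefficients are absorbed into the left factors. The families are indexed by all of [nat], so
    that an induction on [n] can keep them without reindexing. *)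
Lemma tens_sum (t : tensor_rep A B) :
  exists n (a : nat -> A) (b : nat -> B), t = \sum_(i < n) tens (a i) (b i).
Proof.
have [x <-] := quot_map_surj t.
pose z i := nth (0, 0) (dom x) i.
exists (size (dom x)), (fun i => coeff (z i) x *: (z i).1), (fun i => (z i).2).
rewrite -{1}(freeg_sumE x) linear_sum (big_nth (0, 0)) big_mkord.
apply: eq_bigr => i _; rewrite freegZ linearZ_LR tensZl.
by rewrite /tens -surjective_pairing.
Qed.

Section Lift.
Variables (M : lmodType R) (f : A -> B -> M).
Hypotheses (f_linear_l : forall b, linear (f^~ b)).
Hypotheses (f_linear_r : forall a, linear (f a)).

Let f1 (p : A * B) := f p.1 p.2.

Let fglift_linear : linear (fglift f1).
Proof.
move=> a x y.
pose fA := GRing.isZmodMorphism.Build _ _ (fglift f1) (lift_is_additive f1).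
pose fL : {additive F -> M} := HB.pack (fglift f1) fA.
have fE D : fL D = \sum_(z <- dom D) coeff z D *: fL << z >>.
  rewrite -{1}(freeg_sumE D) raddf_sum; apply: eq_bigr => z _.
  by rewrite /= !liftU scale1r.
have aE : a *: x = \sum_(z <- dom x) << a * coeff z x *g z >>.
  rewrite -{1}(freeg_sumE x) scaler_sumr; apply: eq_bigr => z _.
  by rewrite freegZ scalerA -freegZ.
rewrite -[fglift f1]/(fL : _ -> _) raddfD; congr (_ + _).
rewrite aE raddf_sum fE scaler_sumr; apply: eq_bigr => z _.
by rewrite /= !liftU scale1r scalerA.
Qed.

Let lift_rel x : tensor_relation x -> fglift f1 x = 0.
Proof.
pose L := linear_map fglift_linear; rewrite -[fglift f1]/(L : _ -> _).
have LU p : L << p >> = f1 p by rewrite /= liftU scale1r.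
pose fl b := linear_map (f_linear_l b); pose fr a := linear_map (f_linear_r a).
elim=> [a a' b|a b b'|c a b|c a b||y z _ IHy _ IHz|c y _ IHy].
- rewrite !linearB !LU; rewrite /f1/= -[f _ b]/(fl b _) linearD /=.
  by rewrite addrAC addrK subrr.
- rewrite !linearB !LU; rewrite /f1/= -[f a (b + b')]/(fr a _) linearD /=.
  by rewrite addrAC addrK subrr.
- rewrite linearB linearZ_LR !LU; rewrite /f1/= -[f _ b]/(fl b _) linearZ_LR.
  by rewrite subrr.
- rewrite linearB linearZ_LR !LU /f1/= -[f a (c *: b)]/(fr a _) linearZ_LR.
  by rewrite subrr.
- exact: linear0.
- by rewrite linearD IHy IHz addr0.
- by rewrite linearZ_LR IHy scaler0.
Qed.

(** Bilinearity of [f] makes its linear extension to the free module vanish on the tensor relations,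
    so that it descends to the quotient. *)
Lemma tensor_lift : exists L : {linear tensor_rep A B -> M},
  forall a b, L (tens a b) = f a b.
Proof.
pose L := linear_map fglift_linear.
(* The preimage in the free module is arbitrary; [gE] shows that the value does not depend on it. *)
pose g (t : tensor_rep A B) := L (projT1 (cid (quot_map_surj t))).
have gE x : g (quot_map _ x) = L x.
  rewrite /g; case: cid => y /= /quot_piP xy; have := lift_rel xy.
  by rewrite -[fglift f1 _]/(L _) linearB => /eqP; rewrite subr_eq0 => /eqP.
have glin : linear g.
  move=> c s t; have [x <-] := quot_map_surj s; have [y <-] := quot_map_surj t.
  by rewrite -linearP !gE linearP.
exists (linear_map glin) => a b.
by rewrite -[LHS]/(g (tens a b)) gE /= liftU scale1r.
Qed.

End Lift.

End TensorProduct.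

(** * Contractions of a tensor product with linear forms on one factor *)

Section Contraction.
Variables (R : fieldType) (G1 G2 : groupType) (A : rep R G2) (B : rep R G1).

Lemma tensor_ext (M : lmodType R) (f g : {linear tensor_rep A B -> M}) :
  (forall a b, f (tens a b) = g (tens a b)) -> f =1 g.
Proof.
move=> fg t; have [n [a [b ->]]] := tens_sum t; rewrite !linear_sum.
by apply: eq_bigr => i _; exact: fg.
Qed.

Lemma contract_l_subproof (l : {linear A -> R^o}) :
  exists L : {linear tensor_rep A B -> B},
    forall a b, L (tens a b) = (l a : R) *: b.
Proof.
apply: tensor_lift => [b c x y|a c x y].
  by rewrite linearP scalerDl -scalerA.
by rewrite scalerDr !scalerA mulrC.
Qed.

Definition contract_l l := projT1 (cid (contract_l_subproof l)).

Lemma contract_lE l a b : contract_l l (tens a b) = (l a : R) *: b.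
Proof. by rewrite /contract_l; case: cid. Qed.

Lemma contract_r_subproof (l : {linear B -> R^o}) :
  exists L : {linear tensor_rep A B -> A},
    forall a b, L (tens a b) = (l b : R) *: a.
Proof.
apply: tensor_lift => [b c x y|a c x y].
  by rewrite scalerDr !scalerA mulrC.
by rewrite linearP scalerDl -scalerA.
Qed.

Definition contract_r l := projT1 (cid (contract_r_subproof l)).

Lemma contract_rE l a b : contract_r l (tens a b) = (l b : R) *: a.
Proof. by rewrite /contract_r; case: cid. Qed.

(** Both sides are the form $l \otimes m$. *)
Lemma contract_lr (l : {linear A -> R^o}) (m : {linear B -> R^o}) t :
  l (contract_r m t) = m (contract_l l t).
Proof.
apply: (tensor_ext (f := l \o contract_r m) (g := m \o contract_l l)) => a b.
by rewrite /= contract_lE contract_rE !linearZ_LR; exact: mulrC.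
Qed.

(* Induction on the number of pure tensors: a first factor depending linearly
   on the others is absorbed into them, and an independent one is isolated by a
   functional. *)
Lemma contract_l_inj (t : tensor_rep A B) :
  (forall l, contract_l l t = 0) -> t = 0.
Proof.
have [n [a [b ->]]] := tens_sum t; elim: n a b => [|n IHn] a b.
  by rewrite !big_ord0.
rewrite big_ord_recr /=.
have [[c]|indep] := pselect (Defs.span (mkseq a n) (a n)).
  rewrite size_mkseq => aE t0.
  have -> : tens (a n) (b n) = \sum_(i < n) tens (a i) (c i *: b n).
    rewrite aE -[tens _ _]/(linear_map (tens_linear_l (b n)) _) linear_sum.
    apply: eq_bigr => i _.
    by rewrite nth_mkseq //= tensZl tensZr.
  rewrite -big_split /=.
  under eq_bigr => i _ do rewrite -tensDr.
  apply: (IHn _ (fun i => b i + c i *: b n)) => l; rewrite -(t0 l).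
  rewrite linear_sum linearD linear_sum contract_lE aE linear_sum scaler_suml.
  rewrite -big_split; apply: eq_bigr => i _ /=.
  rewrite nth_mkseq // !contract_lE linearZ_LR scalerDr -scalerA.
  by rewrite scalerA mulrC scalerA.
have [l [l1 l0]] := functional_off_span indep => t0.
have bn : b n = 0.
  rewrite -(t0 l) linearD linear_sum big1 ?add0r ?contract_lE ?l1 ?scale1r//.
  move=> i _; rewrite contract_lE l0 ?scale0r //.
  have := @span_nth _ _ (mkseq a n) (cast_ord (esym (size_mkseq a n)) i).
  by rewrite /= nth_mkseq ?ltn_ord.
have tn : tens (a n) (b n) = 0 by rewrite bn -(scale0r 0) tensZr scale0r.
rewrite tn addr0; apply: IHn => m; rewrite -(t0 m).
by rewrite tn addr0.
Qed.

End Contraction.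
Arguments contract_l {R G1 G2 A B} l.
Arguments contract_r {R G1 G2 A B} l.

(** * Cancellation of a tensor factor whose endomorphisms are scalars *)

Section Uniqueness.
Variables (R : fieldType) (G1 G2 : groupType).

(** The conclusion of Schur's lemma, isolated so that the cancellation is purely algebraic and the
    property can be carried through a twist. *)
Definition scalar_endomorphisms (B : rep R G1) : Prop :=
  forall T : {linear B -> B}, equivariant T -> exists c : R, forall v, T v = c *: v.

Section Hom.
Variables (A : rep R G2) (B : rep R G1).
Hypothesis schurB : scalar_endomorphisms B.
Variables (m : {linear B -> R^o}) (b0 : B).
Hypothesis mb0 : m b0 = 1.

Lemma contract_r_tens (a : A) : contract_r m (tens a b0) = a.
Proof. by rewrite contract_rE mb0 scale1r. Qed.

Lemma contract_l_act (l : {linear A -> R^o}) g t :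
  contract_l l (act (g, 1%g) t) = act g (contract_l l t : B).
Proof.
apply: (tensor_ext (f := contract_l l \o act (g, 1%g))
  (g := act g \o contract_l l)) => a b.
by rewrite /= [quot_act _ _]act_tens !contract_lE act1 linearZ_LR.
Qed.

Lemma hom_tensor (psi : {linear B -> tensor_rep A B}) :
  (forall g b, psi (act g b) = act (g, 1%g) (psi b)) ->
  forall b, psi b = tens (contract_r m (psi b0)) b.
Proof.
(* Both sides are compared after contraction with each [l]. On the left, [contract_l l \o psi] is
   multiplication by some [c]; on the right the coefficient is [m (c *: b0)], which is [c] because
   [m b0 = 1]. *)
move=> psiE b; apply/eqP; rewrite -subr_eq0; apply/eqP/contract_l_inj => l.
have [|c cE] := @schurB (contract_l l \o psi).
  by move=> g v; rewrite /= psiE contract_l_act.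
rewrite linearB contract_lE contract_lr.
rewrite -[contract_l l (psi b)]/((contract_l l \o psi) b) cE.
rewrite -[contract_l l (psi b0)]/((contract_l l \o psi) b0) cE.
rewrite (linearZ_LR m) mb0.
by rewrite [_ *: 1]mulr1 subrr.
Qed.

End Hom.

(** For fixed [a], the map $b \mapsto \phi(a \otimes b)$ has the form given by [hom_tensor], so
    $\phi = f \otimes \mathrm{id}$; likewise $\phi^{-1} = f' \otimes \mathrm{id}$. Contracting with
    [m] at [b0] shows that [f] and [f'] are mutually inverse. *)
Lemma tensor_cancel (A A' : rep R G2) (B : rep R G1) :
  scalar_endomorphisms B -> (exists b : B, b != 0) ->
  rep_iso (tensor_rep A B) (tensor_rep A' B) -> rep_iso A A'.
Proof.
move=> schurB [b0 b0_neq0] [phi [[phi' phiK phi'K] phiE]].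
have [m mb0] := functional_nonzero b0_neq0.
have phi'E g t : phi' (act g t) = act g (phi' t).
  by apply: (can_inj phiK); rewrite phiE !phi'K.
have phi'_linear : linear phi' := can2_linear phiK phi'K.
pose lphi' := linear_map phi'_linear.
pose f : {linear A -> A'} := contract_r m \o phi \o linear_map (tens_linear_l b0).
pose f' : {linear A' -> A} := contract_r m \o lphi' \o linear_map (tens_linear_l b0).
have fE a b : phi (tens a b) = tens (f a) b.
  apply: (hom_tensor schurB mb0 (psi := phi \o linear_map (tens_linear_r a))).
  by move=> g v; rewrite -phiE act_tens act1.
have f'E a b : phi' (tens a b) = tens (f' a) b.
  apply: (hom_tensor schurB mb0 (psi := lphi' \o linear_map (tens_linear_r a))).
  by move=> g v; rewrite -phi'E act_tens act1.
exists f; split.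
  exists f' => a.
    by rewrite -(contract_r_tens mb0 (f' _)) -f'E -fE phiK contract_r_tens.
  by rewrite -(contract_r_tens mb0 (f _)) -fE -f'E phi'K contract_r_tens.
move=> g a; rewrite -(contract_r_tens mb0 (f _)) -fE.
(* Writing [b0] as [act 1 b0] turns the action of [g] on [a] alone into that of [(1, g)] on the
   tensor, where [phi] is equivariant. *)
rewrite -[in LHS](act1 (G := G1) b0) -[tens _ _](act_tens (1%g, g)) phiE fE.
by rewrite act_tens /= act1 contract_r_tens.
Qed.

End Uniqueness.

(** * Eigenvectors over an algebraically closed field, and Schur's lemma *)

Section Eigenvector.
Variables (R : closedFieldType) (V : lmodType R) (T : {linear V -> V}).

Lemma iter_linear n : linear (iter n T).
Proof. by elim: n => [|n IHn] a x y //=; rewrite IHn linearP. Qed.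

(** This is $p(T)v$, written out as a sum because [V] may be infinite dimensional and [T] has no
    matrix. *)
Definition poly_act (p : {poly R}) (v : V) : V :=
  \sum_(i < size p) p`_i *: iter i T v.

Lemma poly_act_widen n (p : {poly R}) v : (size p <= n)%N ->
  poly_act p v = \sum_(i < n) p`_i *: iter i T v.
Proof.
move=> pn; rewrite /poly_act (big_ord_widen n (fun i => p`_i *: iter i T v)) //.
rewrite big_mkcond; apply: eq_bigr => i _; case: ltnP => // pi.
by rewrite nth_default // scale0r.
Qed.

Lemma poly_act_mulXsubC (p : {poly R}) r v :
  poly_act (p * ('X - r%:P)) v = poly_act p (T v - r *: v).
Proof.
have sz : (size (p * ('X - r%:P))%R <= (size p).+1)%N.
  by apply: leq_trans (size_polyMleq _ _) _; rewrite size_XsubC addn2.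
rewrite (poly_act_widen _ sz).
transitivity (\sum_(i < (size p).+1) (p * 'X)`_i *: iter i T v -
    \sum_(i < (size p).+1) (r * p`_i) *: iter i T v).
  rewrite -sumrB; apply: eq_bigr => i _.
  by rewrite mulrBr coefB coefMC scalerBl [r * _]mulrC.
(* The two sums are aligned: the one shifted by ['X] loses its term of index 0, the other its last
   term, where the coefficient of [p] is 0. *)
rewrite big_ord_recl coefMX eqxx scale0r add0r.
rewrite [X in _ - X]big_ord_recr /= [p`_(size p)]nth_default // mulr0 scale0r.
rewrite addr0 -sumrB; apply: eq_bigr => i _.
rewrite coefMX /= -iterS iterSr.
have TE : iter i T (T v - r *: v) = iter i T (T v) - r *: iter i T v.
  by rewrite addrC -scaleNr iter_linear scaleNr addrC.
by rewrite TE scalerBr scalerA [r * _]mulrC.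
Qed.

(** Split [p] into linear factors and remove them one at a time: either $(T - r)v = 0$ and [v] is an
    eigenvector, or $(T - r)v$ is a nonzero vector killed by a shorter product. A nonzero constant
    kills no nonzero vector. *)
Lemma eigenvector_of_poly_act (p : {poly R}) v : p != 0 -> v != 0 ->
  poly_act p v = 0 -> exists c w, w != 0 /\ T w = c *: w.
Proof.
have [rs ->] := closed_field_poly_normal p.
rewrite -lead_coef_eq0; set c := lead_coef p.
have [->|c0 _] := eqVneq c 0; first by rewrite scale0r lead_coef0 eqxx.
elim: rs v => [|r rs IHrs] v v0.
  rewrite big_nil (@poly_act_widen 1) ?big_ord1 /=; last first.
    by rewrite size_scale ?size_poly1.
  rewrite coefZ coef1 mulr1 => /eqP; rewrite scaler_eq0 (negPf c0) (negPf v0).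
  by [].
rewrite big_cons mulrC scalerAl poly_act_mulXsubC.
have [Tv _|Tv] := eqVneq (T v - r *: v) 0; last exact: IHrs.
by exists r, v; split => //; apply/eqP; rewrite -subr_eq0 Tv.
Qed.

Lemma eigenvector_in_span (s : seq V) v :
  (forall w, Defs.span s w -> Defs.span s (T w)) -> Defs.span s v -> v != 0 ->
  exists c w, w != 0 /\ T w = c *: w.
Proof.
move=> sT sv v0; pose n := size s.
have /choice[c cE] i : exists c : nat -> R, iter i T v = \sum_(j < n) c j *: s`_j.
  by elim: i => [//|i IHi] /=; exact: sT.
(* Row [i] holds coordinates of $T^i v$. With [n.+1] rows and [n] columns there is a nonzero
   relation [u] between the rows, and its entries are the coefficients of a polynomial that kills
   [v]. *)
pose C := \matrix_(i < n.+1, j < n) c i j.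
have /rowV0Pn[u uC u0] : kermx C != 0.
  by rewrite -mxrank_eq0 mxrank_ker subn_eq0 -ltnNge ltnS rank_leq_col.
apply: (@eigenvector_of_poly_act (rVpoly u) v) => //.
  by apply: contra_neq u0 => u0; rewrite -[u]rVpolyK u0 linear0.
rewrite (poly_act_widen _ (size_poly _ _)).
transitivity (\sum_(j < n) (u *m C) 0 j *: s`_j); last first.
  by rewrite (sub_kermxP uC) big1 // => j _; rewrite mxE scale0r.
under eq_bigr => i _ do rewrite coef_rVpoly_ord cE scaler_sumr.
rewrite exchange_big; apply: eq_bigr => j _.
by rewrite mxE scaler_suml; apply: eq_bigr => i _; rewrite mxE scalerA.
Qed.

End Eigenvector.

Lemma schur_admissible (R : closedFieldType) (G : topGroupType) (V : rep R G) :
  locally_profinite G -> smooth V -> irreducible V -> admissible V ->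
  scalar_endomorphisms V.
Proof.
move=> [_ small] smV [[v v0] irrV] admV T TE.
(* [K] is taken inside the open stabilizer of [v], so that the finite-dimensional space of [K]-fixed
   vectors contains the nonzero vector [v]. *)
have [|K cK KU] := small [set g | act g v = v].
  by apply: open_nbhs_nbhs; split; [exact: smV | exact: act1].
have [s sE] := admV K cK.
have [w sw||c [w [w0 Tw]]] := @eigenvector_in_span _ _ T s v _ _ v0.
- rewrite -sE in sw * => g Kg.
  by rewrite -TE sw.
- by rewrite -sE => g /KU.
exists c.
(* The eigenspace for [c] is a subrepresentation containing [w], hence everything. *)
pose W : set V := [set x | T x = c *: x].
have W0 : W 0 by rewrite /W /= linear0 scaler0.
have WD x y : W x -> W y -> W (x + y).
  by rewrite /W /= linearD scalerDr => -> ->.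
have WZ a x : W x -> W (a *: x).
  by rewrite /W /= linearZ_LR => ->; rewrite !scalerA mulrC.
have Wact g x : W x -> W (act g x) by rewrite /W /= TE => ->; rewrite linearZ_LR.
have [/= WE|/= WE] := irrV (Subrep W0 WD WZ Wact).
  by move: Tw; rewrite -[_ = _]/(W w) WE /= => /eqP; rewrite (negPf w0).
by move=> x; have : W x by rewrite WE.
Qed.

(** * Isomorphisms of representations and the first isomorphism theorem *)

Section RepIso.
Variables (R : fieldType) (G : groupType).
Implicit Types U V W : rep R G.

Lemma rep_iso_sym V W : rep_iso V W -> rep_iso W V.
Proof.
move=> [f [[f' fK f'K] fE]].
exists (linear_map (can2_linear fK f'K)); split; first by exists f.
by move=> g v; apply: (can_inj fK); rewrite fE !f'K.
Qed.

Lemma rep_iso_trans U V W : rep_iso U V -> rep_iso V W -> rep_iso U W.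
Proof.
move=> [f [f_bij fE]] [h [h_bij hE]]; exists (h \o f); split; first exact: bij_comp.
by move=> g v; rewrite /= fE hE.
Qed.

Lemma rep_first_iso V W (K : subrep V) (p : {linear V -> W}) :
  equivariant p -> (forall w, exists v, p v = w) ->
  (forall v, p v = 0 <-> subrep_set K v) -> rep_iso (quot_rep K) W.
Proof.
move=> pE /choice[s sK] pK.
pose f (x : quot_rep K) := p (projT1 (cid (quot_map_surj x))).
have fE v : f (quot_map K v) = p v.
  rewrite /f; case: cid => w /= /quot_piP/pK.
  by rewrite linearB => /eqP; rewrite subr_eq0 => /eqP.
have flin : linear f.
  move=> a x y; have [v <-] := quot_map_surj x; have [w <-] := quot_map_surj y.
  by rewrite -linearP !fE linearP.
exists (linear_map flin); split.
  exists (quot_map K \o s) => [x|w]; last by rewrite /= [f _]fE sK.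
  have [v <-] := quot_map_surj x; rewrite /= [f _]fE; apply/quot_piP/pK.
  by rewrite linearB sK subrr.
move=> g x; have [v <-] := quot_map_surj x.
by rewrite act_quot_map /= [f _]fE pE -fE.
Qed.

End RepIso.

(** * Compatibility of the Galois twist with isotypic quotients, tensor products and scalar
    endomorphisms *)

Section TwistIso.
Variables (R0 R : fieldType) (iota : {rmorphism R0 -> R}).
Implicit Type sigma : galois_aut iota.

Lemma galois_inv_fixes sigma x : gal_inv sigma (iota x) = iota x.
Proof. by rewrite -{1}(gal_fixes sigma) gal_funK. Qed.

Definition galois_inv sigma : galois_aut iota :=
  GaloisAut (gal_invK sigma) (gal_funK sigma) (galois_inv_fixes sigma).

Lemma twist_linear sigma (G G' : groupType) (V : rep R G) (W : rep R G')
    (f : {linear V -> W}) :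
  linear (f : twist sigma V -> twist sigma W).
Proof. by move=> a v w; exact: linearP. Qed.

Arguments twist_linear sigma {G G' V W} f.

Lemma twist_linear_inv sigma (G G' : groupType) (V : rep R G) (W : rep R G')
    (f : {linear twist sigma V -> twist sigma W}) :
  linear (f : V -> W).
Proof.
(* Twisted scalars act through the inverse of [sigma], so [sigma a] acts as [a]. *)
move=> a v w; have := linearP f (sigma a) v w.
by rewrite /= /GRing.scale /= /twist_scale gal_funK.
Qed.

Lemma twist_rep_iso sigma (G : groupType) (V W : rep R G) :
  rep_iso V W -> rep_iso (twist sigma V) (twist sigma W).
Proof.
move=> [f [f_bij fE]]; exists (linear_map (twist_linear sigma f)).
by split=> // g v; exact: fE.
Qed.

(** The same functions are homomorphisms before and after twisting, so the two isotypic kernels are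
    the same subset of [V]. *)
Lemma twist_isotypic_quotient sigma (G1 G2 : groupType)
    (V : rep R (G1 * G2)%type) (B : rep R G1) :
  rep_iso (isotypic_quotient (twist sigma V) (twist sigma B))
          (twist sigma (isotypic_quotient V B)).
Proof.
pose p := linear_map (twist_linear sigma (quot_map (isotypic_kernel V B))).
apply: (rep_first_iso (p := p)) => [g v|w|v].
- by rewrite [RHS]act_quot_map.
- exact: (quot_map_surj (w : isotypic_quotient V B)).
- apply: iff_trans; first exact: quot_map_eq0.
  apply: (_ : @isotypic_kernel_set _ _ _ V B v <->
    @isotypic_kernel_set _ _ _ (twist sigma V) (twist sigma B) v).
  split=> kv f fE.
    exact: (kv (linear_map (twist_linear_inv f))).
  exact: (kv (linear_map (twist_linear sigma f))).
Qed.

Lemma twist_tensor sigma (G1 G2 : groupType) (A : rep R G2) (B : rep R G1) :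
  rep_iso (tensor_rep (twist sigma A) (twist sigma B))
          (twist sigma (tensor_rep A B)).
Proof.
set T := tensor_rep A B; set T' := tensor_rep (twist sigma A) (twist sigma B).
have [L LE] : exists L : {linear T' -> twist sigma T},
    forall a b, L (tens a b) = tens (a : A) (b : B).
  apply: tensor_lift => [b|a] c x y.
    exact: tens_linear_l.
  exact: tens_linear_r.
(* The inverse of [L] is only semilinear as a map from [T] to [T']; twisting the target by the
   inverse of [sigma] makes it linear, as the universal property requires. *)
have [L' L'E] : exists L' : {linear T -> twist (galois_inv sigma) T'},
    forall a b, L' (tens a b) = tens (a : twist sigma A) (b : twist sigma B).
  apply: tensor_lift => [b|a] c x y.
    rewrite -[RHS](tens_linear_l (b : twist sigma B)).
    by congr (tens (_ + _) _); rewrite /= [RHS]/GRing.scale /= /twist_scale gal_funK.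
  rewrite -[RHS](tens_linear_r (a : twist sigma A)).
  by congr (tens _ (_ + _)); rewrite /= [RHS]/GRing.scale /= /twist_scale gal_funK.
(* In both composites [sigma] cancels its inverse, so they are linear for the original structures
   and can be compared with the identity on pure tensors. *)
have L'L_linear : linear (L' \o L : T' -> T').
  move=> c x y; rewrite /= (linearP L).
  rewrite -[X in L' X]/(gal_inv sigma c *: (L x : T) + (L y : T)) (linearP L').
  rewrite -[LHS]/(sigma (gal_inv sigma c) *: (L' (L x) : T') + L' (L y)).
  by rewrite gal_invK.
have LL'_linear : linear (L \o L' : T -> T).
  move=> c x y; rewrite /= (linearP L').
  rewrite -[X in L X]/(sigma c *: (L' x : T') + (L' y : T')) (linearP L).
  rewrite -[LHS]/(gal_inv sigma (sigma c) *: (L (L' x) : T) + L (L' y)).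
  by rewrite gal_funK.
exists L; split.
  exists L'.
    apply: (tensor_ext (f := linear_map L'L_linear) (g := idfun)) => a b.
    by rewrite /= LE L'E.
  apply: (tensor_ext (f := linear_map LL'_linear) (g := idfun)) => a b.
  by rewrite /= L'E LE.
move=> g.
apply: (tensor_ext (f := L \o act g) (g := act g \o L)) => a b.
by rewrite /= [quot_act _ _]act_tens !LE [RHS]act_tens.
Qed.

Lemma twist_scalar_endomorphisms sigma (G : groupType) (B : rep R G) :
  scalar_endomorphisms B -> scalar_endomorphisms (twist sigma B).
Proof.
move=> schurB T TE.
have [//|c cE] := schurB (linear_map (twist_linear_inv T)).
by exists (sigma c) => v; rewrite [RHS]/GRing.scale /= /twist_scale gal_funK -cE.
Qed.

End TwistIso.

Theorem theorem4p8
  (R0 : fieldType) (hR0 : prime_field R0)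
  (R : closedFieldType) (iota : {rmorphism R0 -> R})
  (hR : algebraic_closure iota)
  (H1 H2 : topGroupType)
  (hH1 : locally_profinite H1) (hH2 : locally_profinite H2)
  (hpro : exists2 K : set (H1 * H2)%type,
      compact_open_subgroup K & invertible_pro_order R K)
  (hadm1 : forall pi : rep R H1, smooth pi -> irreducible pi -> admissible pi)
  (hadm2 : forall pi : rep R H2, smooth pi -> irreducible pi -> admissible pi)
  (V : rep R (H1 * H2)%type) (hV : smooth V)
  (sigma : galois_aut iota)
  (pi1 : rep R H1) (hpi1 : smooth pi1) (hirr : irreducible pi1)
  (Theta : rep R H2) (hTheta : is_isotypic_lift V pi1 Theta)
  (Theta' : rep R H2)
  (hTheta' : is_isotypic_lift (twist sigma V) (twist sigma pi1) Theta') :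
  (twist sigma Theta ~= Theta')%rep.
Proof.

have [[b b0] _] := hirr.
(* Schur's lemma is applied to [pi1] and then carried to its twist, which spares proving the twist
   irreducible and admissible. *)
have schur := schur_admissible hH1 hpi1 hirr (hadm1 _ hpi1 hirr).
apply: (tensor_cancel (twist_scalar_endomorphisms (sigma := sigma) schur)).
  by exists b.
(* The chain is ${}^\sigma\Theta \otimes {}^\sigma\pi_1 \simeq {}^\sigma(\Theta \otimes \pi_1)
   \simeq {}^\sigma(V_{\pi_1}) \simeq ({}^\sigma V)_{{}^\sigma\pi_1} \simeq \Theta' \otimes
   {}^\sigma\pi_1$. *)
apply: rep_iso_trans (twist_tensor _ _ _) _.
apply: rep_iso_trans _ (proj2 hTheta').
apply: rep_iso_trans _ (rep_iso_sym (twist_isotypic_quotient _ _ _)).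
exact: twist_rep_iso (rep_iso_sym (proj2 hTheta)).
Qed.
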